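(* Let $\mu\ge 0$ and let $w\in C([0,\infty))\cap C^1(0,\infty)$ be real-valued such that, for some $r_0>0$, $\delta>0$, $2w(r)=\frac{\mu}{r}+\widetilde w(r)$ with $|\widetilde w(r)|\lesssim r^{-1-\delta}$ for $r\ge r_0$. Let $\varphi,\psi\in C([0,\infty))$ satisfy $$\varphi(r)\equiv 0,\qquad \psi(r)\ge (1+r)^{-\kappa}\quad\text{for } r\ge 0$$ for some $\kappa>0$, and set $\nu=\kappa-\mu/2-1$. Let $T(\varepsilon)$ be the lifespan of the integral equation $$u(t,r)=\varepsilon u_L(t,r)+\frac12\iint_{\Delta_-(t,r)}E_-(t-\sigma,r,y)\,\frac{|u(\sigma,y)|^p}{y^{p-1}}\,dy\,d\sigma .$$ If either $1<p\le p_S(3+\mu)$ and $p\nu=1$, or $1<p<p_F(\kappa)$ and $p\nu<1$, then there exist $C>0$ and $\varepsilon_0>0$ such that for any $\varepsilon\in(0,\varepsilon_0]$ $$T(\varepsilon)\le\begin{cases}\exp(C\varepsilon^{-(p-1)}) & (p=p_S(3+\mu)\text{ and }p\nu=1),\\ C\,b(\varepsilon) & (1<p<p_S(3+\mu)\text{ and }p\nu=1),\\ C\varepsilon^{-(p-1)/\gamma_F(p,\kappa)} & (1<p<p_F(\kappa)\text{ and }p\nu<1).\end{cases}$$ Here $\gamma_F(p,\kappa)=2-(p-1)\kappa$, and (for $1<p<p_S(3+\mu)$) $b(\varepsilon)>0$ is defined by $$b(\varepsilon)\{\log(1+b(\varepsilon))\}^{2(p-1)/\gamma_S(p,3+\mu)}=\varepsilon^{-2p(p-1)/\gamma_S(p,3+\mu)}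 .$$
   Context: $A\lesssim B$ means $A\le CB$ with a constant $C>0$. $\gamma_S(p,n):=2+(n+1)p-(n-1)p^2$; for real $n>1$, $p_S(n)$ is the positive root of $\gamma_S(p,n)=0$; $p_F(\kappa)=1+2/\kappa$. $W(r)=\int_0^r w(\tau)\,d\tau$ and, for $t,r\ge0$, $y\ge t-r$, $$E_-(t,r,y)=e^{-W(r)}e^{2W((y-t+r)/2)}e^{-W(y)}.$$ $$\Delta_-(t,r)=\{(\sigma,y)\in(0,\infty)\times(0,\infty):\ |t-r|<\sigma+y<t+r,\ \sigma-y<t-r\}.$$ The free solution is $$u_L(t,r)=\frac12\int_{|t-r|}^{t+r}E_-(t,r,y)\big(\psi(y)+\varphi'(y)+w(y)\varphi(y)\big)dy+\chi(r-t)E_-(t,r,r-t)\varphi(r-t),$$ with $\chi(s)=1$ for $s\ge0$ and $\chi(s)=0$ for $s<0$ (here $\varphi\equiv0$, so only the $\psi$ term remains). The lifespan $T(\varepsilon)\in(0,\infty]$ is the maximal existence time, i.e. the supremum of all $T>0$ such that the integral equation has a continuous solution $u$ on $[0,T)\times(0,\infty)$. (The integral equation is the integral form, for $u=rU$, of the radial Cauchy problem $(\partial_t^2+2w(r)\partial_t-\Delta+V(r))U=|U|^p$ on $\mathbb R^3$ with $V=-w'+w^2$, and $rU(0)=\varepsilon\varphi$, $r\partial_tU(0)=\varepsilon\psi$.) *)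

(* Defs.v *)
From HB Require Import structures.
From mathcomp Require Import all_boot all_order all_algebra.
From mathcomp Require Import all_classical all_reals all_analysis.

Set Implicit Arguments.
Unset Strict Implicit.
Unset Printing Implicit Defensive.

Import Order.TTheory GRing.Theory Num.Theory.
Import numFieldNormedType.Exports.

Local Open Scope classical_set_scope.
Local Open Scope ring_scope.

Section exponents.
Context {R : realType}.
Implicit Types p n kappa mu eps : R.

Definition gammaS p n : R := 2 + (n + 1) * p - (n - 1) * p ^+ 2.

(* For n > 1 there is exactly one positive root; 0 is a junk value for the
   remaining n. *)
Definition pS n : R := xget 0 [set p : R | 0 < p /\ gammaS p n = 0].

Definition pF kappa : R := 1 + 2 / kappa.

Definition gammaF p kappa : R := 2 - (p - 1) * kappa.

(* For 1 < p < pS (3 + mu) and eps > 0 the left-hand side increases from 0 to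
   +oo with b, so there is exactly one such b; 0 is a junk value otherwise. *)
Definition b_eps p mu eps : R :=
  xget 0 [set b : R | 0 < b /\
    b * (ln (1 + b)) `^ (2 * (p - 1) / gammaS p (3 + mu)) =
    eps `^ (- (2 * p * (p - 1) / gammaS p (3 + mu)))].

End exponents.

Section integral_equation.
Context {R : realType}.
Implicit Types (w phi psi : R -> R) (p eps t r y T : R) (u : R * R -> R).

Definition bigW w r : R := \int[lebesgue_measure]_(tau in `[0, r]) w tau.

Definition Eminus w t r y : R :=
  expR (- bigW w r) * expR (2 * bigW w ((y - t + r) / 2)) *
  expR (- bigW w y).

(* A point of R * R is (sigma, y), with the time variable first. *)
Definition Delta_minus t r : set (R * R) :=
  [set z | [/\ 0 < z.1, 0 < z.2, `|t - r| < z.1 + z.2,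
               z.1 + z.2 < t + r & z.1 - z.2 < t - r]].

Definition chi (s : R) : R := if 0 <= s then 1 else 0.

Definition uL w phi psi t r : R :=
  2^-1 * (\int[lebesgue_measure]_(y in `[`|t - r|, t + r])
            (Eminus w t r y * (psi y + derive1 phi y + w y * phi y))) +
  chi (r - t) * Eminus w t r (r - t) * phi (r - t).

(* The double integral has a nonnegative integrand and is taken in \bar R:
   as the left-hand side is a real number, the equation includes the
   convergence of that integral. *)
Definition integral_eq w phi psi p eps u t r : Prop :=
  ((u (t, r))%:E =
   (eps * uL w phi psi t r)%:E +
   (2^-1)%:E *
   \int[(@lebesgue_measure R \x @lebesgue_measure R)%E]_(z in Delta_minus t r)
     (Eminus w (t - z.1) r z.2 * (`|u z| `^ p / z.2 `^ (p - 1)))%:E)%E.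

Definition strip T : set (R * R) :=
  [set z | [/\ 0 <= z.1, z.1 < T & 0 < z.2]].

Definition solution_on w phi psi p eps T u : Prop :=
  {within strip T, continuous u} /\
  (forall t r, strip T (t, r) -> integral_eq w phi psi p eps u t r).

Definition lifespan w phi psi p eps : \bar R :=
  ereal_sup [set T%:E | T in
    [set T : R | 0 < T /\ exists u, solution_on w phi psi p eps T u]].

End integral_equation.

(* Main.v *)
Require Import Defs.
From mathcomp Require Import all_boot all_order all_algebra.
From mathcomp Require Import all_classical all_reals all_analysis.
From mathcomp Require Import measurable_realfun.
From mathcomp Require Import ring lra.
Import Order.TTheory GRing.Theory Num.Theory.
Import numFieldNormedType.Exports.
Local Open Scope classical_set_scope.
Local Open Scope ring_scope.

(** Write [alpha = t - r] and [beta = t + r] for the characteristic coordinates.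
    Since [W] differs from [mu / 2 * ln] by a bounded function
    ([bigW_sub_ln_bounded]), the kernel satisfies the homogeneous lower bound
    [E >= c * r ^ (- mu / 2) * (y - alpha) ^ mu * y ^ (- mu / 2)] as soon as its
    arguments are not small. All lower bounds for a solution are of the form
    [D * r ^ (- mu / 2) * alpha ^ (- theta)] on a cone [beta >= 4 * alpha]
    ([lower_bound]); the free solution provides one with [D] of order [eps] and
    [theta = nu] ([uL_lower]).

    Blow-up is local. On the square [X <= alpha <= 2 * X],
    [8 * X <= beta <= 9 * X] everything is homogeneous in [X], and the equation
    becomes [u >= A + B * (double integral of u ^ p)] with [A] given by the lower
    bound and [B] of order [X ^ (3 - p)]. If [A ^ (p - 1) * B] is large, the lower
    bounds for [u] on squares shrinking geometrically to their common corner grow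
    geometrically, which is absurd because [u] is finite at that corner
    ([local_blowup]). In terms of [D] and [theta], a solution that lives beyond a
    multiple of [X] has [D ^ (p - 1) * X ^ (3 - p - (p - 1) * (mu / 2 + theta))]
    below a fixed constant ([lower_bound_lt]).

    For [p * nu < 1] the free solution is inserted there; the exponent of [X] is
    [gammaF p kappa], and the bound follows.

    For [p * nu = 1] the [p]-th power of [alpha ^ (- nu)] is [alpha ^ -1], whose
    integral is a logarithm: from [D] one gets [D ^ p * ln alpha], with [theta]
    replaced by [p - 2 + mu / 2 * (p - 1)] ([log_step]). Below [pS (3 + mu)] one
    such step, followed by [lower_bound_lt], whose exponent of [X] is now half of
    [gammaS p (3 + mu)], gives the comparison with [b_eps]. At [pS (3 + mu)] the
    new [theta] is again [nu] and the exponent of [X] is zero. The step is then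
    iterated on slices of the logarithmic scale [ln alpha] of geometrically
    decreasing length: a scale of length [S] with [S * eps ^ (p - 1)] large
    suffices to lift the coefficient from order [eps] to a fixed constant, and
    [S] is the logarithm of the time needed ([critical_iteration]). *)

(** * Lower bounds for integrals of nonnegative functions *)

(** The integral of a nonnegative function is a supremum over the simple
    functions below it, hence monotone on arbitrary functions. The larger
    function will be the nonlinear integrand of a solution, which is only known
    to be continuous on a strip. *)
Lemma ge0_le_integral_subset {d} {T : measurableType d} {R : realType}
    (m : {measure set T -> \bar R}) (A D : set T) (f g : T -> \bar R) :
  A `<=` D -> (forall z, D z -> (0 <= f z)%E) ->
  (forall z, A z -> (0 <= g z)%E) -> (forall z, A z -> (g z <= f z)%E) ->
  (\int[m]_(z in A) g z <= \int[m]_(z in D) f z)%E.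
Proof.
move=> AD f0 g0 gf; rewrite !ge0_integralE//.
apply: ereal_sup_le => _ [h /= hg <-].
exists h => //= z; apply: le_trans (hg z) _.
rewrite /patch; case: ifPn => [/set_mem Az|_].
  by rewrite (mem_set (AD _ Az)) gf.
by case: ifPn => // /set_mem /f0.
Qed.

Lemma cst_le_integral {d} {T : measurableType d} {R : realType}
    (m : {measure set T -> \bar R}) (A D : set T) (f : T -> \bar R) (c : R) :
  measurable A -> A `<=` D -> 0 <= c -> (forall z, D z -> (0 <= f z)%E) ->
  (forall z, A z -> (c%:E <= f z)%E) ->
  (c%:E * m A <= \int[m]_(z in D) f z)%E.
Proof.
move=> mA AD c0 f0 cf; rewrite -integral_cst//.
by apply: ge0_le_integral_subset.
Qed.

Lemma integral_inv_shift {R : realType} (k y c d : R) : 0 < c -> c < d ->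
  (\int[@lebesgue_measure R]_(x in `[(y + c)%R, (y + d)%R]) (k / (x - y))%:E =
   (k * (ln d - ln c))%:E)%E.
Proof.
move=> c0 cd.
have pos x : y + c <= x -> 0 < x - y.
  by move=> h; rewrite subr_gt0 (lt_le_trans _ h)// ltrDl.
have dln x : y + c <= x -> is_derive x 1 (fun x => k * ln (x - y)) (k / (x - y)).
  move=> h.
  have dl := is_derive1_ln (pos _ h).
  have ds : is_derive x 1 (fun x : R => x - y) 1.
    by apply: is_derive_eq; rewrite subr0.
  have := is_deriveZ k (@is_derive1_comp _ _ (fun x => x - y) x _ _ dl ds).
  by rewrite mulr1.
rewrite (@continuous_FTC2 _ _ (fun x => k * ln (x - y))).
- by rewrite addrAC subrr add0r addrAC subrr add0r -EFinB -mulrBr.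
- by rewrite ltrD2l.
- apply: derivable_within_continuous => x; rewrite in_itv/= => /andP[h _].
  apply: derivableM; first exact: derivable_cst.
  apply: derivableV; first exact: lt0r_neq0 (pos _ h).
  exact: ex_derive.
- have cl x : y + c <= x -> {for x, continuous (fun x => k * ln (x - y))}.
    move=> /dln h; apply: differentiable_continuous; apply/derivable1_diffP.
    exact: ex_derive.
  split.
  + by move=> x; rewrite in_itv/= => /andP[/ltW/dln h _]; exact: ex_derive.
  + by apply: cvg_at_right_filter; apply: cl.
  + by apply: cvg_at_left_filter; apply: cl; rewrite lerD2l ltW.
- move=> x; rewrite in_itv/= => /andP[/ltW/dln h _].
  by rewrite derive1E; apply: derive_val.
Qed.

Definition parallelogram {R : realType} (a b c d : R) : set (R * R) :=
  [set z | a <= z.2 <= b /\ c <= z.1 - z.2 <= d].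

(** The sides of the parallelogram are lines [y = const] and characteristics
    [sigma - y = const]. Slicing it along the former, each slice is a translate
    of [[c, d]] and carries the same mass [k * ln (d / c)]: this is where all
    logarithms come from. *)
Lemma integral_inv_parallelogram {R : realType} (k a b c d : R) :
  0 <= k -> a < b -> 0 < c -> c < d ->
  (\int[(@lebesgue_measure R \x @lebesgue_measure R)%E]_(z in
      parallelogram a b c d)
     (k / (z.1 - z.2))%:E = (k * (b - a) * (ln d - ln c))%:E)%E.
Proof.
move=> k0 ab c0 cd; set Q := parallelogram a b c d.
have mQ : measurable Q.
  rewrite (_ : Q = (snd @^-1` `[a, b]) `&`
                   ((fun z : R * R => z.1 - z.2) @^-1` `[c, d])).
    apply: measurableI; rewrite -[X in measurable X]setTI.
    - by apply: measurable_snd.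
    - apply: measurable_funB => //.
  by apply/seteqP; split => z /=; rewrite !in_itv.
(* The power -1 replaces the inverse because its measurability is available;
   both agree on the parallelogram. *)
pose g := (fun z : R * R => (k * (z.1 - z.2) `^ (-1))%:E) \_ Q.
have mg : measurable_fun setT g.
  have mf : measurable_fun setT (fun z : R * R => k * (z.1 - z.2) `^ (-1)).
    apply: measurable_funM => //.
    apply: (measurableT_comp (measurable_powR (-1))).
    exact: measurable_funB.
  apply: (iffLR (measurable_restrictT _ mQ)); apply/measurable_EFinP.
  exact: measurable_funTS.
have g0 z : (0 <= g z)%E.
  by rewrite /g /patch; case: ifP => // _; rewrite lee_fin mulr_ge0 ?powR_ge0.
transitivity (\int[(@lebesgue_measure R \x @lebesgue_measure R)%E]_z g z)%E.
  rewrite integral_mkcond; apply: eq_integral => z _.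
  rewrite /g /patch; case: ifPn => // /set_mem [_ /andP[h _]].
  by rewrite powR_inv1// (le_trans _ h)// ltW.
rewrite fubini_tonelli2// /fubini_G.
transitivity (\int[@lebesgue_measure R]_(y in `[a, b]) (k * (ln d - ln c))%:E)%E.
  rewrite [RHS]integral_mkcond; apply: eq_integral => y _.
  rewrite [RHS]/patch mem_setE; case: ifPn => yab.
    rewrite -(@integral_inv_shift _ k y)// [RHS]integral_mkcond.
    apply: eq_integral => x _; rewrite /g /patch.
    have xE : ((x, y) \in Q) = (x \in `[y + c, y + d]).
      apply/idP/idP.
      + move=> /set_mem [_ /=]; rewrite in_itv/=; lra.
      + by rewrite in_itv/= => h; apply/mem_set; split => /=; [|lra].
    rewrite xE mem_setE; case: ifPn => // /[!in_itv]/= h.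
    by rewrite powR_inv1//; lra.
  apply: integral0_eq => x _; rewrite /g /patch; case: ifPn => // /set_mem [] /=.
  by move=> h; move: yab; rewrite in_itv/= h.
by rewrite integral_cst//= lebesgue_measure_itv/= lte_fin ab -EFinB -EFinM mulrAC.
Qed.

(** * Real powers *)

Lemma powR_expR {R : realType} (x a : R) : 0 < x -> x `^ a = expR (a * ln x).
Proof. by move=> x0; rewrite /powR gt_eqF. Qed.

Lemma ler_powR2r {R : realType} (a x y : R) : 0 <= a -> 0 <= x -> x <= y ->
  x `^ a <= y `^ a.
Proof.
move=> a0 x0 xy; apply: ge0_ler_powR => //; rewrite nnegrE//.
exact: le_trans xy.
Qed.

Lemma ler_powR2rN {R : realType} (a x y : R) : 0 <= a -> 0 < x -> x <= y ->
  y `^ (- a) <= x `^ (- a).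
Proof.
move=> a0 x0 xy; rewrite !powRN lef_pV2 ?posrE ?powR_gt0//; last first.
  exact: lt_le_trans xy.
by apply: ler_powR2r => //; exact: ltW.
Qed.

Lemma powRN_ge1 {R : realType} (a x : R) : 0 <= a -> 0 < x -> x <= 1 ->
  1 <= x `^ (- a).
Proof. by move=> a0 x0 x1; have := ler_powR2rN _ _ _ a0 x0 x1; rewrite powR1. Qed.

Lemma expR_unbounded {R : realType} (l M : R) : 0 < l -> exists k : nat, M < expR (k%:R * l).
Proof.
move=> l0; exists (Num.bound (`|M| / l)).
apply: le_lt_trans (ler_norm M) _.
have h : `|M| < (Num.bound (`|M| / l))%:R * l.
  by rewrite -ltr_pdivrMr// archi_boundP// divr_ge0// ltW.
apply: lt_le_trans h _; apply: le_trans (expR_ge1Dx _); by rewrite lerDr.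
Qed.

Lemma pow2_between {R : realType} (Y : R) : 1 <= Y ->
  exists n : nat, Y <= 2 ^+ n /\ 2 ^+ n <= 2 * Y.
Proof.
move=> Y1; have ln2 : 0 < ln (2 : R) by apply: ln_gt0; lra.
have ex : exists n : nat, Y <= 2 ^+ n.
  have [k hk] := expR_unbounded _ Y ln2; exists k; apply: ltW.
  by move: hk; rewrite expRM_natl lnK ?posrE.
case: (ex_minnP ex) => n nY nmin; exists n; split => //.
case: n nY nmin => [|n] nY nmin; first by rewrite expr0; lra.
rewrite exprS ler_pM2l// leNgt; apply/negP => lt.
by have := nmin n (ltW lt); rewrite ltnn.
Qed.

Lemma exists_powR_ge {R : realType} (m k g K : R) : 0 < k -> 0 < g -> 0 <= K ->
  exists2 M : R, m <= M & K <= k * M `^ g.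
Proof.
move=> k0 g0 K0; exists (Num.max m ((K / k) `^ g^-1)).
  by rewrite le_max lexx.
rewrite -ler_pdivrMl// mulrC.
have Kk : 0 <= K / k by rewrite divr_ge0// ltW.
rewrite -[leLHS](powRr1 Kk) -(mulVf (lt0r_neq0 g0)) powRrM.
by apply: ler_powR2r; rewrite ?powR_ge0 ?(ltW g0)// le_max lexx orbT.
Qed.

(** * The weight and the kernel *)

Lemma continuous_at_gt0 {R : realType} (w : R -> R) (x : R) :
  {within `[0, +oo[, continuous w} -> 0 < x -> {for x, continuous w}.
Proof.
move=> cw x0; have : {within `]0, +oo[, continuous w}.
  by apply: continuous_subspaceW cw; apply: subset_itvr; rewrite bnd_simp.
rewrite continuous_open_subspace; last exact: interval_open.
by apply; rewrite inE/= in_itv/= x0.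
Qed.

Lemma integrable_segment {R : realType} (w : R -> R) (a b : R) : 0 <= a ->
  {within `[0, +oo[, continuous w} ->
  (@lebesgue_measure R).-integrable `[a, b] (EFin \o w).
Proof.
move=> a0 cw; apply: continuous_compact_integrable; first exact: segment_compact.
apply: continuous_subspaceW cw => x /=; rewrite !in_itv/= andbT => /andP[ax _].
exact: le_trans ax.
Qed.

Lemma is_derive_bigW {R : realType} (w : R -> R) (x : R) :
  {within `[0, +oo[, continuous w} -> 0 < x ->
  is_derive x 1 (bigW w) (w x).
Proof.
move=> cw x0; have x1 : x < x + 1 by rewrite ltrDl.
have [d1 d2] := continuous_FTC1_closed x1 (integrable_segment w 0 (x + 1) (lexx 0) cw)
  x0 (continuous_at_gt0 w x cw x0).
by apply: DeriveDef; [exact: d1|rewrite -derive1E; exact: d2].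
Qed.

(** The derivative of [W - mu / 2 * ln] is [wt / 2], whose bound has the bounded
    primitive [- A / (2 * delta) * x ^ (- delta)]; adding that primitive to
    [W - mu / 2 * ln] or to its opposite gives two monotone functions. *)
Lemma bigW_sub_ln_bounded {R : realType} (mu r0 delta A : R) (w wt : R -> R) :
  {within `[0, +oo[, continuous w} -> 0 < r0 -> 0 < delta -> 0 < A ->
  (forall r : R, r0 <= r -> 2 * w r = mu / r + wt r) ->
  (forall r : R, r0 <= r -> `|wt r| <= A * r `^ (- 1 - delta)) ->
  exists2 M : R, 0 <= M &
    forall x, r0 <= x -> `|bigW w x - mu / 2 * ln x| <= M.
Proof.
move=> cw r0_gt0 d0 A0 wE wtA.
pose D x : R := bigW w x - mu / 2 * ln x.
pose K := A / (2 * delta).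
have K0 : 0 <= K by rewrite divr_ge0 ?mulr_ge0 ?ltW.
pose F (s x : R) := s * D x - K * x `^ (- delta).
have dF (s x : R) : 0 < x ->
    is_derive x 1 (F s) (s * (w x - mu / 2 * x^-1) -
                         K * (- delta * x `^ (- delta - 1))).
  move=> x0.
  have hW := is_derive_bigW w x cw x0.
  have hl := is_derive1_ln x0.
  have hp := is_derive1_powR (- delta) x0.
  rewrite /F /D.
  have e (f : R -> R) (c df : R) : is_derive x 1 f df ->
      is_derive x 1 (fun x => c * f x) (c * df).
    by move=> h; exact: (is_deriveZ c h).
  by apply: is_deriveB; apply: e; apply: is_deriveB; apply: e.
have F_mono (s : R) : `|s| <= 1 -> forall x : R, r0 <= x -> F s r0 <= F s x.
  move=> s1 x; apply: ger0_derive1_ndecry => //.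
  - move=> y; rewrite in_itv/= andbT => h; apply: ex_derive; apply: dF.
    exact: lt_trans h.
  - move=> y; rewrite in_itv/= andbT => h.
    have y0 : 0 < y by exact: lt_trans h.
    rewrite derive1E; have -> := @derive_val _ _ _ _ _ _ _ (dF s y y0).
    have wy : w y - mu / 2 / y = wt y / 2.
      by rewrite -[w y](@mulKf _ 2)// (wE _ (ltW h)); field; exact: lt0r_neq0.
    rewrite wy mulNr mulrN opprK (_ : - delta - 1 = - 1 - delta); last by ring.
    have -> : K * (delta * y `^ (- 1 - delta)) = A * y `^ (- 1 - delta) / 2.
      by rewrite /K; field; exact: lt0r_neq0.
    have : `|s * wt y| <= A * y `^ (- 1 - delta).
      by rewrite normrM (le_trans _ (wtA _ (ltW h)))// ler_piMl.
    by rewrite ler_norml => /andP[] *; lra.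
  - apply: derivable_within_continuous => y; rewrite in_itv/= andbT => h.
    by apply: ex_derive; apply: dF; exact: lt_le_trans h.
exists (`|D r0| + K * r0 `^ (- delta)).
  apply: addr_ge0; first exact: normr_ge0.
  by apply: mulr_ge0 => //; exact: powR_ge0.
move=> x hx; rewrite -/(D x).
have N1 : `|1 : R| <= 1 by rewrite normr1.
have N2 : `|- 1 : R| <= 1 by rewrite normrN normr1.
have := F_mono _ N1 _ hx; have := F_mono _ N2 _ hx; rewrite /F.
have : 0 <= K * x `^ (- delta) by rewrite mulr_ge0 ?powR_ge0.
have := ler_norm (D r0); have := ler_norm (- D r0); rewrite normrN.
rewrite ler_norml => *; apply/andP; split; lra.
Qed.

(** For [x >= r0], [exp (W x)] is comparable with [x ^ (mu / 2)], and this is the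
    resulting bound on the kernel. *)
Definition kernel_bound {R : realType} (mu r0 c : R) (w : R -> R) : Prop :=
  forall t r y, r0 <= r -> r0 <= y -> 2 * r0 <= y - t + r ->
    c * (r `^ (- (mu / 2)) * (y - t + r) `^ mu * y `^ (- (mu / 2))) <=
    Eminus w t r y.

Lemma kernel_lower {R : realType} (mu r0 M : R) (w : R -> R) : 0 < r0 ->
  (forall x, r0 <= x -> `|bigW w x - mu / 2 * ln x| <= M) ->
  exists2 c : R, 0 < c & kernel_bound mu r0 c w.
Proof.
move=> r0_gt0 WM; exists (expR (- (4 * M) - mu * ln 2)); first exact: expR_gt0.
move=> t r y hr hy hs; set s := y - t + r in hs *.
have s0 : 0 < s by apply: lt_le_trans hs; rewrite mulr_gt0.
have s2 : r0 <= s / 2 by rewrite ler_pdivlMr// mulrC.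
have r_gt0 : 0 < r by exact: lt_le_trans hr.
have y_gt0 : 0 < y by exact: lt_le_trans hy.
rewrite !powR_expR// /Eminus -!expRD ler_expR -/s.
have lns : ln (s / 2) = ln s - ln 2 by rewrite ln_div ?posrE.
have := WM _ hr; have := WM _ hy; have := WM _ s2; rewrite lns !ler_norml.
set a := bigW w r; set b := bigW w y; set c := bigW w _.
set m := mu / 2; have -> : mu = 2 * m by rewrite /m; field.
rewrite mulrBr; set ms := m * ln s; set m2 := m * ln 2.
have -> : 2 * m * ln 2 = 2 * m2 by rewrite /m2 mulrA.
have -> : 2 * m * ln s = 2 * ms by rewrite /ms mulrA.
set mr := m * ln r; set my := m * ln y.
rewrite !mulNr -/mr -/my; lra.
Qed.

Lemma within_continuous_comp_within {R : realType} (A B : set R) (f g : R -> R) :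
  f @` A `<=` B -> {within A, continuous f} -> {within B, continuous g} ->
  {within A, continuous (g \o f)}.
Proof.
move=> AB /subspace_continuousP cf /subspace_continuousP cg.
apply/subspace_continuousP => x Ax.
have Bfx : B (f x) by apply: AB; exists x.
apply: cvg_comp (cg _ Bfx) => P /= BP.
rewrite /= in BP *; have := cf x Ax _ BP.
change (nbhs x (fun y => A y -> B (f y) -> P (f y)) ->
        nbhs x (fun y => A y -> P (f y))).
apply: filterS => y h Ay; apply: h => //.
by apply: AB; exists y.
Qed.

Lemma within_continuous_bigW {R : realType} (w : R -> R) :
  {within `[0, +oo[, continuous w} -> {within `[0, +oo[, continuous (bigW w)}.
Proof.
move=> cw; apply/continuous_within_itvcyP; split.
  move=> x; rewrite in_itv/= andbT => x0.
  apply: differentiable_continuous; apply/derivable1_diffP.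
  by have := is_derive_bigW w x cw x0 => h; exact: ex_derive.
have := parameterized_integral_continuous (ler01 : 0 <= 1 :> R)
  (integrable_segment w 0 1 (lexx 0) cw).
by move=> /continuous_within_itvP-/(_ ltr01)[].
Qed.

(** At the left endpoint [y = t - r] the argument of [W] in the middle factor is
    [0], the end of the half-line on which [W] is meant, whence the continuity
    within half-lines. *)
Lemma within_continuous_Eminus {R : realType} (w : R -> R) (t r : R) :
  {within `[0, +oo[, continuous w} -> r <= t ->
  {within `[t - r, +oo[, continuous (Eminus w t r)}.
Proof.
move=> cw rt; have cW := within_continuous_bigW w cw.
have cexp (A : set R) (f : R -> R) : {within A, continuous f} ->
    {within A, continuous (fun x => expR (f x))}.
  by move=> cf x; apply: continuous_comp; [exact: cf|exact: continuous_expR].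
have cshift : {within `[t - r, +oo[, continuous (fun y => bigW w ((y - t + r) / 2))}.
  apply: (within_continuous_comp_within _ `[0, +oo[ (fun y => (y - t + r) / 2)).
  - move=> _ [y /= hy <-]; move: hy; rewrite !in_itv/=; lra.
  - apply: continuous_subspaceT => y.
    apply: cvgM; last exact: cvg_cst.
    by apply: cvgD; [apply: cvgB; [exact: cvg_id|exact: cvg_cst]|exact: cvg_cst].
  - exact: cW.
have cid : {within `[t - r, +oo[, continuous (bigW w)}.
  by apply: continuous_subspaceW cW; apply: subset_itvr; rewrite bnd_simp subr_ge0.
have c1 : {within `[t - r, +oo[,
    continuous (fun y => expR (2 * bigW w ((y - t + r) / 2)))}.
  by apply: cexp => y; apply: cvgM; [exact: cvg_cst|exact: cshift].
have c2 : {within `[t - r, +oo[, continuous (fun y => expR (- bigW w y))}.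
  by apply: cexp => y; apply: cvgN; exact: cid.
move=> y; apply: cvgM; last exact: c2.
by apply: cvgM; [exact: cvg_cst|exact: c1].
Qed.

Lemma Eminus_ge0 {R : realType} (w : R -> R) t r y : 0 <= Eminus w t r y.
Proof. by rewrite !mulr_ge0// expR_ge0. Qed.

(** * The free solution *)

Lemma uL_psi {R : realType} (w phi psi : R -> R) (t r : R) :
  (forall x : R, 0 <= x -> phi x = 0) -> 0 < r -> r < t ->
  uL w phi psi t r = 2^-1 * fine (\int[@lebesgue_measure R]_(y in
    `[(t - r)%R, (t + r)%R]) (Eminus w t r y * psi y)%:E)%E.
Proof.
move=> phi0 r0 rt; have tr0 : 0 < t - r by rewrite subr_gt0.
rewrite /uL /chi (_ : (0 <= r - t) = false) ?mul0r ?addr0; last lra.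
rewrite ger0_norm ?ltW//; congr (_ * fine _).
apply: eq_integral => y; rewrite inE/= in_itv/= => /andP[y1 _].
have y0 : 0 < y by exact: lt_le_trans y1.
rewrite phi0 ?ltW// mulr0 addr0 derive1E.
rewrite (@near_eq_derive _ _ _ _ (cst 0)) ?derive_cst ?addr0//.
near=> z; apply: phi0; apply: ltW; near: z; exact: lt_nbhsr.
Unshelve. all: by end_near. Qed.

(** For [t + r >= 4 * (t - r)] the range [2 * (t - r) <= y <= 4 * (t - r)] lies in
    the domain of integration, and there [y], [1 + y] and [y - (t - r)] are all
    comparable with [t - r]. The product of the length of the range with the
    kernel and with the lower bound for [psi] has the stated powers. *)
Lemma uL_lower {R : realType} (mu r0 c kappa : R) (w phi psi : R -> R) :
  0 <= mu -> 0 < r0 -> 0 < c -> kernel_bound mu r0 c w ->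
  {within `[0, +oo[, continuous w} -> {within `[0, +oo[, continuous psi} ->
  (forall x : R, 0 <= x -> phi x = 0) -> 0 < kappa ->
  (forall x : R, 0 <= x -> (1 + x) `^ (- kappa) <= psi x) ->
  exists2 d : R, 0 < d & forall t r, 1 <= t - r -> 2 * r0 <= t - r ->
    4 * (t - r) <= t + r ->
    d * (r `^ (- (mu / 2)) * (t - r) `^ (- (kappa - mu / 2 - 1))) <=
    uL w phi psi t r.
Proof.
move=> mu0 r00 c0 Ek cw cpsi phi0 k0 psil.
exists (c * (4 `^ (- (mu / 2)) * 5 `^ (- kappa))).
  by rewrite !mulr_gt0// powR_gt0.
move=> t r h1 h2 h4; set al := t - r in h1 h2 h4 *.
have al0 : 0 < al by lra.
have r1 : al <= r by rewrite /al in al0 h4 *; lra.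
rewrite uL_psi//; [|lra|rewrite /al in al0; lra].
rewrite -/al.
set I := (\int[_]_(y in _) _)%E.
pose f y := (Eminus w t r y * psi y)%:E.
have f0 y : `[al, t + r]%classic y -> (0 <= f y)%E.
  rewrite /= in_itv/= => /andP[hy _]; rewrite lee_fin mulr_ge0 ?Eminus_ge0//.
  by rewrite (le_trans (powR_ge0 _ _) (psil _ _))//; lra.
have Ifin : I \is a fin_num.
  apply: integrable_fin_num => //.
  apply: continuous_compact_integrable; first exact: segment_compact.
  move=> y; apply: cvgM.
    apply: (continuous_subspaceW _ (within_continuous_Eminus w t r cw _)).
      by apply: subset_itvl.
    by rewrite /al in al0; lra.
  apply: (continuous_subspaceW _ cpsi) => z /=; rewrite !in_itv/=; lra.
pose K := c * (r `^ (- (mu / 2)) * al `^ mu * (4 * al) `^ (- (mu / 2))) *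
  (5 * al) `^ (- kappa).
have K0 : 0 <= K by rewrite /K !mulr_ge0 ?powR_ge0// ltW.
have : (K%:E * @lebesgue_measure R `[(2 * al)%R, (4 * al)%R] <= I)%E.
  apply: cst_le_integral => //.
    by move=> y /=; rewrite !in_itv/=; lra.
  move=> y /=; rewrite in_itv/= => /andP[y1 y2]; rewrite lee_fin /K.
  apply: ler_pM.
  - by rewrite !mulr_ge0 ?powR_ge0// ltW.
  - exact: powR_ge0.
  - apply: le_trans (Ek t r y _ _ _); rewrite -/al; [|lra|lra|].
    + apply: ler_wpM2l; first exact: ltW.
      apply: ler_pM; rewrite ?mulr_ge0 ?powR_ge0//.
      * apply: ler_wpM2l; first exact: powR_ge0.
        by apply: ler_powR2r => //; [lra|rewrite /al in y1 *; lra].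
      * by apply: ler_powR2rN => //; [rewrite divr_ge0|lra].
    + by rewrite /al in y1 h2 *; lra.
  - apply: le_trans (psil _ _); last lra.
    by apply: ler_powR2rN => //; [exact: ltW|lra|lra].
rewrite lebesgue_measure_itv/= lte_fin.
have -> : 2 * al < 4 * al by lra.
rewrite -EFinD -EFinM -(fineK Ifin) lee_fin => H.
rewrite ler_pdivlMl// (le_trans _ H)//.
rewrite le_eqVlt; apply/orP; left; apply/eqP.
rewrite /K !powRM ?ltW//.
have -> : al `^ (- (kappa - mu / 2 - 1)) =
    al * (al `^ mu * al `^ (- (mu / 2)) * al `^ (- kappa)).
  rewrite -{2}(lnK al0) !powR_expR// -!expRD; congr expR; by field.
ring.
Qed.

(** * Lower bounds for a solution *)

Section Nonlinear.
Context {R : realType} (mu r0 c d nu p eps T : R) (w phi psi : R -> R).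
Context (u : R * R -> R).
Context (mu_ge0 : 0 <= mu) (r0_gt0 : 0 < r0) (c_gt0 : 0 < c) (d_gt0 : 0 < d).
Context (p_gt1 : 1 < p) (eps_gt0 : 0 < eps).
Context (Ek : kernel_bound mu r0 c w).
Context (free_lower : forall t r, 1 <= t - r -> 2 * r0 <= t - r ->
  4 * (t - r) <= t + r ->
  d * (r `^ (- (mu / 2)) * (t - r) `^ (- nu)) <= uL w phi psi t r).
Context (sol : solution_on w phi psi p eps T u).

Definition integrand (t r : R) (z : R * R) : R :=
  Eminus w (t - z.1) r z.2 * (`|u z| `^ p / z.2 `^ (p - 1)).

Lemma integrand_ge0 t r z : 0 <= integrand t r z.
Proof. by rewrite mulr_ge0 ?Eminus_ge0// divr_ge0// powR_ge0. Qed.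

Lemma solution_ge t r (I : \bar R) : strip T (t, r) ->
  (I <= \int[(@lebesgue_measure R \x @lebesgue_measure R)%E]_(z in
      Delta_minus t r) (integrand t r z)%:E)%E ->
  ((eps * uL w phi psi t r)%:E + (2^-1)%:E * I <= (u (t, r))%:E)%E.
Proof.
move=> str hI; have [_ /(_ _ _ str) ->] := sol.
by apply: leeD2l; apply: lee_wpmul2l => //; rewrite lee_fin invr_ge0.
Qed.

Lemma solution_ge_free t r : strip T (t, r) ->
  eps * uL w phi psi t r <= u (t, r).
Proof.
move=> str; have := @solution_ge t r 0%E str; rewrite mule0 adde0 lee_fin.
by apply; apply: integral_ge0 => z _; rewrite lee_fin integrand_ge0.
Qed.

Lemma solution_ge_integral t r (I : R) : strip T (t, r) ->
  1 <= t - r -> 2 * r0 <= t - r -> 4 * (t - r) <= t + r ->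
  (I%:E <= \int[(@lebesgue_measure R \x @lebesgue_measure R)%E]_(z in
      Delta_minus t r) (integrand t r z)%:E)%E ->
  2^-1 * I <= u (t, r).
Proof.
move=> str h1 h2 h3 /(solution_ge _ _ _ str); rewrite -EFinM -EFinD lee_fin.
apply: le_trans; rewrite lerDr mulr_ge0 ?(ltW eps_gt0)//.
apply: le_trans (free_lower _ _ h1 h2 h3).
by rewrite !mulr_ge0 ?powR_ge0// ltW.
Qed.

(** The cone [t + r >= 4 * (t - r)] keeps away from the axis [r = 0]. The part
    of [Delta_minus t r] that [log_step] integrates over consists of points of the
    same cone, so the cone does not shrink under iteration. *)
Definition lower_bound (a D theta : R) : Prop :=
  forall t r, t < T -> a <= t - r -> 4 * (t - r) <= t + r ->
    D * (r `^ (- (mu / 2)) * (t - r) `^ (- theta)) <= u (t, r).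

Lemma lower_bound_le (a a' D D' theta : R) : a <= a' -> D' <= D ->
  lower_bound a D theta -> lower_bound a' D' theta.
Proof.
move=> aa DD lb t r tT h h4; apply: le_trans (lb t r tT (le_trans aa h) h4).
by apply: ler_wpM2r => //; rewrite mulr_ge0 ?powR_ge0.
Qed.

Lemma lower_bound_free (a : R) : 1 <= a -> 2 * r0 <= a ->
  lower_bound a (eps * d) nu.
Proof.
move: r0_gt0 eps_gt0 => r00 e0 a1 ar t r tT h h4.
have str : strip T (t, r) by split => /=; lra.
apply: le_trans (solution_ge_free _ _ str).
by rewrite -mulrA ler_pM2l//; apply: free_lower => //; lra.
Qed.

(** The powers of [3 / 2] come from [y <= 3 / 2 * (t - r)], the factor [1 / 4] from
    the coefficient [1 / 2] of the double integral and from the length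
    [(t - r) / 2] of the range of [y]. *)
Definition log_gain : R :=
  c / 4 * ((3 / 2) `^ (- (mu / 2)) * ((3 / 2) `^ (- (mu / 2 * p)) *
           (3 / 2) `^ (- (p - 1)))).

Lemma log_gain_gt0 : 0 < log_gain.
Proof. by rewrite /log_gain !mulr_gt0 ?powR_gt0// divr_gt0. Qed.

(** When [theta * p = 1], the [p]-th power of the lower bound decays exactly like
    [(sigma - y) ^ -1] across the characteristics, and its integral over
    [a <= sigma - y <= (t - r) / 8] is a logarithm. The range
    [t - r <= y <= 3 / 2 * (t - r)] in the other variable guarantees at once that
    these points lie in [Delta_minus t r], that they lie in the cone, and that
    [y] and [sigma + y - (t - r)] are comparable with [t - r]; collecting the
    powers of [t - r] produces the exponent [p - 2 + mu / 2 * (p - 1)]. *)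
Lemma log_step (a m theta : R) : 1 <= a -> 2 * r0 <= a -> 0 <= m ->
  theta * p = 1 -> lower_bound a m theta ->
  forall t r, t < T -> 8 * a < t - r -> 4 * (t - r) <= t + r ->
    log_gain * m `^ p * ln ((t - r) / (8 * a)) *
      (r `^ (- (mu / 2)) * (t - r) `^ (- (p - 2 + mu / 2 * (p - 1)))) <=
    u (t, r).
Proof.
move: mu_ge0 r0_gt0 c_gt0 p_gt1 => mu0 r00 c0 p1.
move=> a1 ar0 m0 thp lb t r tT h8 h4; set al := t - r in h8 h4 *.
have a0 : 0 < a by lra.
have al0 : 0 < al by lra.
have rgt : al <= r by rewrite /al in al0 h4 *; lra.
have rgt0 : 0 < r by lra.
have tpos : 0 <= t by rewrite /al in al0; lra.
have [B BE] : exists B, B = 3 / 2 * al by exists (3 / 2 * al).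
have B0 : 0 < B by lra.
pose K := c * (r `^ (- (mu / 2)) * al `^ mu * B `^ (- (mu / 2))) *
  (m `^ p * B `^ (- (mu / 2 * p)) * B `^ (- (p - 1))).
have K0 : 0 <= K by rewrite /K !mulr_ge0 ?powR_ge0// ltW.
have str : strip T (t, r) by [].
have hAD : parallelogram al B a (al / 8) `<=` Delta_minus t r.
  move=> [s y] [/= /andP[y1 y2] /andP[s1 s2]].
  have nE : `|t - r| = al by rewrite ger0_norm// ltW.
  rewrite /Delta_minus; split => /=; rewrite ?nE;
    rewrite /al in BE h8 al0 h4 y1 y2 s2 *; lra.
have key : (( K * (B - al) * (ln (al / 8) - ln a))%:E <=
    \int[(@lebesgue_measure R \x @lebesgue_measure R)%E]_(z in
      Delta_minus t r) (integrand t r z)%:E)%E.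
  rewrite -integral_inv_parallelogram//; [|lra|lra].
  apply: ge0_le_integral_subset => //.
  - by move=> z _; rewrite lee_fin integrand_ge0.
  - move=> z [_ /andP[z1 _]]; rewrite lee_fin divr_ge0//; lra.
  move=> [s y] hz; have [/= /andP[y1 y2] /andP[s1 s2]] := hz.
  have [/= _ _ _ D1 D2] := hAD _ hz.
  have y0 : 0 < y by lra.
  rewrite lee_fin /integrand /K -mulrA /=.
  apply: ler_pM.
  - by rewrite !mulr_ge0 ?powR_ge0// ltW.
  - by rewrite divr_ge0 ?mulr_ge0 ?powR_ge0//; lra.
  - apply: le_trans (Ek (t - s) r y _ _ _); [|lra|lra|rewrite /al in y1 ar0 h8 *; lra].
    apply: ler_wpM2l; first exact: ltW.
    apply: ler_pM; rewrite ?mulr_ge0 ?powR_ge0//.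
    + apply: ler_wpM2l; first exact: powR_ge0.
      by apply: ler_powR2r => //; [lra|rewrite /al in y1 *; lra].
    + by apply: ler_powR2rN => //; rewrite divr_ge0.
  - have lbz : m * (y `^ (- (mu / 2)) * (s - y) `^ (- theta)) <= `|u (s, y)|.
      apply: le_trans (ler_norm _); apply: lb => //; last lra.
      by rewrite /al in D1 D2; lra.
    have sy0 : 0 < s - y by lra.
    apply: (@le_trans _ _ ((m * (y `^ (- (mu / 2)) * (s - y) `^ (- theta))) `^ p
        * y `^ (- (p - 1)))); last first.
      rewrite [y `^ (- (p - 1))]powRN; apply: ler_wpM2r.
        by rewrite invr_ge0 powR_ge0.
      apply: ler_powR2r lbz; last by rewrite !mulr_ge0// powR_ge0.
      by apply: ltW; exact: lt_trans p_gt1.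
    rewrite !powRM ?mulr_ge0 ?powR_ge0// -!powRrM !mulNr thp
      powR_inv1 ?(ltW sy0)//.
    rewrite [leLHS](_ : _ = m `^ p / (s - y) *
      (B `^ (- (mu / 2 * p)) * B `^ (- (p - 1)))); last by ring.
    rewrite [leRHS](_ : _ = m `^ p / (s - y) *
      (y `^ (- (mu / 2 * p)) * y `^ (- (p - 1)))); last by ring.
    apply: ler_wpM2l; first by rewrite divr_ge0 ?powR_ge0// ltW.
    apply: ler_pM; rewrite ?powR_ge0//; apply: ler_powR2rN => //; try lra.
    by rewrite !mulr_ge0//; lra.
have t1 : 1 <= t - r by rewrite /al in h8; lra.
have t2 : 2 * r0 <= t - r by rewrite /al in h8; lra.
apply: le_trans (solution_ge_integral _ _ _ str t1 t2 h4 key).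
rewrite le_eqVlt; apply/orP; left; apply/eqP.
have -> : ln (al / (8 * a)) = ln (al / 8) - ln a.
  by rewrite -ln_div ?posrE ?divr_gt0//; congr ln; field; rewrite lt0r_neq0.
rewrite /K /log_gain BE !powRM ?divr_ge0 ?ltW//.
have -> : al `^ (- (p - 2 + mu / 2 * (p - 1))) = al * (al `^ mu *
    al `^ (- (mu / 2)) * al `^ (- (mu / 2 * p)) * al `^ (- (p - 1))).
  rewrite -{2}(lnK al0) !powR_expR// -!expRD; congr expR; by field.
by field.
Qed.

(** * Local blow-up *)

(** In characteristic coordinates the lower bound [m] is known on a square with
    upper corner [(2 * X, 9 * X)] and side [h], and is improved on the square of
    half the side with the same corner. The part of the first square below the
    second one contains a square with sides parallel to the [sigma] and [y] axes
    and of side [h / 8], on which the kernel is at least [c]. *)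
Lemma local_step (X h m : R) : 1 <= X -> 2 * r0 <= X -> 11 / 2 * X < T ->
  0 < h -> h <= X -> 0 <= m ->
  (forall t r, 2 * X - h <= t - r -> t - r <= 2 * X ->
     9 * X - h <= t + r -> t + r <= 9 * X -> m <= u (t, r)) ->
  forall t r, 2 * X - h / 2 <= t - r -> t - r <= 2 * X ->
    9 * X - h / 2 <= t + r -> t + r <= 9 * X ->
    c / 128 * (4 * X) `^ (- (p - 1)) * m `^ p * h ^+ 2 <= u (t, r).
Proof.
move: mu_ge0 r0_gt0 c_gt0 p_gt1 => mu0 r00 c0 p1.
move=> X1 Xr XT d0 dX m0 um t r t1 t2 t3 t4.
have str : strip T (t, r) by split => /=; lra.
pose K := c * (4 * X) `^ (- (p - 1)) * m `^ p.
have K0 : 0 <= K by rewrite /K !mulr_ge0 ?powR_ge0// ltW.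
(* The square is centred at the point with characteristic coordinates
   [2 * X - 3 / 4 * h] and [9 * X - 3 / 4 * h]. *)
pose S1 := `[11 / 2 * X - 13 / 16 * h, 11 / 2 * X - 11 / 16 * h]%classic.
pose S2 := `[7 / 2 * X - h / 16, 7 / 2 * X + h / 16]%classic.
have hS : S1 `*` S2 `<=` Delta_minus t r.
  move=> [s y] []; rewrite /S1 /S2 /= !in_itv/= => /andP[s1 s2] /andP[y1 y2].
  rewrite /Delta_minus; split => /=; rewrite ?ger0_norm; lra.
have S1m : measurable S1 by exact: measurable_itv.
have S2m : measurable S2 by exact: measurable_itv.
have mS1 : @lebesgue_measure R S1 = (h / 8)%:E.
  rewrite lebesgue_measure_itv/= lte_fin ifT; last lra.
  by rewrite -EFinB; congr (_%:E); field.
have mS2 : @lebesgue_measure R S2 = (h / 8)%:E.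
  rewrite lebesgue_measure_itv/= lte_fin ifT; last lra.
  by rewrite -EFinB; congr (_%:E); field.
have key : ((K * (h / 8 * (h / 8)))%:E <=
    \int[(@lebesgue_measure R \x @lebesgue_measure R)%E]_(z in
      Delta_minus t r) (integrand t r z)%:E)%E.
  have -> : ((K * (h / 8 * (h / 8)))%:E =
      K%:E * (@lebesgue_measure R \x @lebesgue_measure R) (S1 `*` S2))%E.
    rewrite product_measure1E// EFinM; congr (_ * _)%E.
    by rewrite EFinM; congr (_ * _)%E; [exact/esym/mS1|exact/esym/mS2].
  apply: cst_le_integral => //.
  - exact: measurableX.
  - by move=> z _; rewrite lee_fin integrand_ge0.
  move=> [s y] hz; have [/= _ _ _ D1 D2] := hS _ hz.
  move: hz => []; rewrite /S1 /S2 /= !in_itv/= => /andP[s1 s2] /andP[y1 y2].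
  have y0 : 0 < y by lra.
  rewrite lee_fin /integrand /K -mulrA /=.
  apply: ler_pM; [exact: ltW|by rewrite mulr_ge0 ?powR_ge0| |].
  - apply: le_trans (Ek (t - s) r y _ _ _); [|lra|lra|lra].
    rewrite -[leLHS]mulr1; apply: ler_wpM2l; first exact: ltW.
    have X4 : 0 < 4 * X by lra.
    have X4E : (4 * X) `^ (- (mu / 2)) * (4 * X) `^ mu * (4 * X) `^ (- (mu / 2)) = 1.
      by rewrite !powR_expR// -!expRD -[RHS]expR0; congr expR; field.
    rewrite -[leLHS]X4E.
    have mu20 : 0 <= mu / 2 by rewrite divr_ge0.
    apply: ler_pM; rewrite ?mulr_ge0 ?powR_ge0//.
      apply: ler_pM; rewrite ?powR_ge0//.
        by apply: ler_powR2rN => //; lra.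
      by apply: ler_powR2r => //; lra.
    by apply: ler_powR2rN => //; lra.
  - rewrite mulrC -powRN; apply: ler_pM; rewrite ?powR_ge0//.
      apply: ler_powR2r => //; first lra.
      apply: le_trans (ler_norm _); apply: um; lra.
    by apply: ler_powR2rN; lra.
have h1 : 1 <= t - r by lra.
have h2 : 2 * r0 <= t - r by lra.
have h3 : 4 * (t - r) <= t + r by lra.
apply: le_trans (solution_ge_integral _ _ _ str h1 h2 h3 key).
by rewrite /K le_eqVlt; apply/orP; left; apply/eqP; field.
Qed.

(** Iterating [local_step] on squares shrinking by a factor [1 / 2] costs a factor
    [1 / 4] at each step. With [l = ln 4 / (p - 1)] the [p]-th power of
    [A * exp (k * l)] wins exactly this factor back, so that a large enough [A]
    makes all the lower bounds [A * exp (k * l)] hold at the common corner, where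
    [u] is finite. *)
Lemma local_blowup (X A : R) : 1 <= X -> 2 * r0 <= X -> 11 / 2 * X < T ->
  0 < A ->
  (forall t r, X <= t - r -> t - r <= 2 * X -> 8 * X <= t + r ->
     t + r <= 9 * X -> A <= u (t, r)) ->
  c / 128 * 4 `^ (- (p - 1)) * (A `^ (p - 1) * X `^ (3 - p)) <
    4 `^ (1 / (p - 1)).
Proof.
move: p_gt1 c_gt0 => p1 c0 X1 Xr XT A0 uA; rewrite ltNge; apply/negP => big.
have pm : 0 < p - 1 by lra.
have X0 : 0 < X by lra.
pose l := ln 4 / (p - 1).
have ln4 : 0 < ln (4 : R) by apply: ln_gt0; lra.
have l0 : 0 < l by rewrite divr_gt0.
have lp : l * (p - 1) = ln 4 by rewrite /l divfK// lt0r_neq0.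
have half k : 0 < X * 2^-1 ^+ k <= X.
  have e1 : (2^-1 : R) ^+ k <= 1 by apply: exprn_ile1; lra.
  have e0 : 0 < (2^-1 : R) ^+ k by apply: exprn_gt0; lra.
  by rewrite mulr_gt0//= ler_piMr// ltW.
have step (k : nat) : forall t r, 2 * X - X * 2^-1 ^+ k <= t - r ->
    t - r <= 2 * X -> 9 * X - X * 2^-1 ^+ k <= t + r -> t + r <= 9 * X ->
    A * expR (k%:R * l) <= u (t, r).
  elim: k => [|k IH] t r h1 h2 h3 h4.
    by rewrite mul0r expR0 mulr1; apply: uA; rewrite ?expr0 in h1 h3; lra.
  have /andP[d0 dX] := half k.
  have Ak0 : 0 <= A * expR (k%:R * l) by rewrite mulr_ge0 ?expR_ge0// ltW.
  have := local_step X _ _ X1 Xr XT d0 dX Ak0 IH t r.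
  rewrite -mulrA -exprSr => /(_ h1 h2 h3 h4); apply: le_trans.
  have Xp : 0 < X `^ (3 - p) by rewrite powR_gt0.
  rewrite [(A * _) `^ _]powRM ?expR_ge0 ?(ltW A0)// -expRM.
  rewrite powRM ?(ltW X0)// exprMn.
  have e2 : (2^-1 ^+ k) ^+ 2 = expR (- (k%:R * ln 4)) :> R.
    rewrite -exprM mulnC exprM -mulrN expRM_natl; congr (_ ^+ k).
    by rewrite expRN lnK ?posrE// expr2 -invfM; congr (_^-1); ring.
  have Ap : A `^ p = A * A `^ (p - 1) by rewrite mulr_powRB1 ?(ltW A0)//; lra.
  have X3 : X `^ (3 - p) = X `^ (- (p - 1)) * X ^+ 2.
    rewrite -(powR_mulrn 2 (ltW X0)) -powRD; last by rewrite lt0r_neq0 ?implybT.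
    by congr (_ `^ _); ring.
  have e3 : expR (k%:R * l * p) * (2^-1 ^+ k) ^+ 2 = expR (k%:R * l).
    by rewrite e2 -expRD; congr expR; rewrite -lp; ring.
  have -> : c / 128 * (4 `^ (- (p - 1)) * X `^ (- (p - 1))) *
      (A `^ p * expR (k%:R * l * p)) * (X ^+ 2 * (2^-1 ^+ k) ^+ 2) =
      A * (expR (k%:R * l) *
           (c / 128 * 4 `^ (- (p - 1)) * (A `^ (p - 1) * X `^ (3 - p)))).
    by rewrite Ap X3 -e3; ring.
  rewrite ler_pM2l// -natr1 mulrDl mul1r expRD ler_pM2l ?expR_gt0//.
  by apply: le_trans big; rewrite powR_expR// /l mul1r mulrC.
have [k hk] := expR_unbounded l (u (11 / 2 * X, 7 / 2 * X) / A) l0.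
have /andP[d0 dX] := half k.
have : A * expR (k%:R * l) <= u (11 / 2 * X, 7 / 2 * X).
  by apply: (step k); lra.
by rewrite leNgt [A * _]mulrC -ltr_pdivrMr// hk.
Qed.

(** The last factor of the denominator bounds [r ^ (- mu / 2)] and
    [(t - r) ^ (- theta)] from below where [r <= 4 * X] and
    [X <= t - r <= 2 * X]; the absolute value covers both signs of [theta]. *)
Definition blowup_threshold (theta : R) : R :=
  4 `^ (1 / (p - 1)) / (c / 128 * 4 `^ (- (p - 1)) *
    (4 `^ (- (mu / 2)) * 2 `^ (- `|theta|)) `^ (p - 1)).

Lemma blowup_threshold_gt0 theta : 0 < blowup_threshold theta.
Proof.
apply: divr_gt0; first exact: powR_gt0.
by rewrite !(mulr_gt0, invr_gt0, powR_gt0).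
Qed.

(** The lower bound is of constant size on the characteristic square of side [X]
    with lower corner [(X, 8 * X)], so that [local_blowup] applies there. This is
    the only source of blow-up in the proof. *)
Lemma lower_bound_lt (X D theta : R) : 1 <= X -> 2 * r0 <= X ->
  11 / 2 * X < T -> 0 < D -> lower_bound X D theta ->
  D `^ (p - 1) * X `^ (3 - p - (p - 1) * (mu / 2 + theta)) <
    blowup_threshold theta.
Proof.
move: mu_ge0 c_gt0 => mu0 c0 X1 Xr XT D0 lb.
have X0 : 0 < X by lra.
have X4 : 0 < 4 * X by lra.
have m0 : 0 <= mu / 2 by rewrite divr_ge0.
pose A := D * ((4 * X) `^ (- (mu / 2)) * (2 `^ (- `|theta|) * X `^ (- theta))).
have A0 : 0 < A by rewrite /A !mulr_gt0 ?powR_gt0.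
have uA t r : X <= t - r -> t - r <= 2 * X -> 8 * X <= t + r ->
    t + r <= 9 * X -> A <= u (t, r).
  move=> h1 h2 h3 h4; have tT : t < T by lra.
  have h5 : 4 * (t - r) <= t + r by lra.
  apply: le_trans (lb t r tT h1 h5).
  apply: ler_wpM2l; first exact: ltW.
  apply: ler_pM; rewrite ?mulr_ge0 ?powR_ge0//.
    by apply: ler_powR2rN => //; lra.
  have [th0|th0] := leP 0 theta.
    rewrite ger0_norm// -powRM//; last exact: ltW.
    by apply: ler_powR2rN => //; lra.
  rewrite ltr0_norm// opprK; apply: (@le_trans _ _ (X `^ (- theta))).
    rewrite ler_piMl ?powR_ge0// -[leRHS](powRr0 2).
    by apply: ler_powR; [lra|exact: ltW].
  by apply: ler_powR2r => //; [rewrite oppr_ge0 ltW|lra].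
have := local_blowup X A X1 Xr XT A0 uA.
have -> : A `^ (p - 1) * X `^ (3 - p) =
    (4 `^ (- (mu / 2)) * 2 `^ (- `|theta|)) `^ (p - 1) *
    (D `^ (p - 1) * X `^ (3 - p - (p - 1) * (mu / 2 + theta))).
  have A_E : A = (4 `^ (- (mu / 2)) * 2 `^ (- `|theta|)) * D *
      X `^ (- (mu / 2) - theta).
    rewrite /A powRM//; last exact: ltW.
    by rewrite [X `^ (- (mu / 2) - theta)]powRD ?(lt0r_neq0 X0) ?implybT//; ring.
  rewrite A_E powRM ?mulr_ge0 ?powR_ge0 ?(ltW D0)//.
  rewrite [(_ * D) `^ _]powRM ?mulr_ge0 ?powR_ge0 ?(ltW D0)//.
  rewrite -!mulrA; congr (_ * (_ * _)).
  rewrite -powRrM -powRD ?(lt0r_neq0 X0) ?implybT//; congr (_ `^ _); ring.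
rewrite mulrA -ltr_pdivlMl ?(mulr_gt0, invr_gt0, powR_gt0)//.
by rewrite /blowup_threshold [_^-1 * _]mulrC.
Qed.

(** * Lifespan bounds *)

(** The free solution alone exceeds the threshold: the scaling exponent in
    [lower_bound_lt] is [gammaF p kappa]. *)
Lemma power_lifespan (M kappa : R) : nu = kappa - mu / 2 - 1 ->
  0 < gammaF p kappa -> eps <= 1 -> 1 <= M -> 2 * r0 <= M ->
  blowup_threshold nu <= d `^ (p - 1) * M `^ gammaF p kappa ->
  T <= 6 * (M * eps `^ (- ((p - 1) / gammaF p kappa))).
Proof.
move: p_gt1 eps_gt0 d_gt0 => p1 e0 d0 nuE g0 e1 M1 Mr big.
rewrite leNgt; apply/negP => TX.
set E := eps `^ _ in TX; set X := M * E in TX.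
have E0 : 0 < E by rewrite powR_gt0.
have E1 : 1 <= E.
  by apply: powRN_ge1 => //; rewrite divr_ge0 ?(ltW g0)//; lra.
have MX : M <= X by rewrite ler_peMr//; lra.
have X1 : 1 <= X by lra.
have Xr : 2 * r0 <= X by lra.
have XT : 11 / 2 * X < T by lra.
have D0 : 0 < eps * d by rewrite mulr_gt0.
have := lower_bound_lt X (eps * d) nu X1 Xr XT D0 (lower_bound_free X X1 Xr).
rewrite ltNge => /negP; apply; apply: le_trans big _.
have -> : 3 - p - (p - 1) * (mu / 2 + nu) = gammaF p kappa.
  by rewrite nuE /gammaF; field.
rewrite powRM ?(ltW e0) ?(ltW d0)// /X powRM ?(ltW E0)//; last lra.
rewrite /E -powRrM (_ : - _ * _ = - (p - 1)); last first.
  by field; rewrite lt0r_neq0.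
rewrite powRN le_eqVlt; apply/orP; left; apply/eqP; field.
by rewrite powR_eq0 negb_and (lt0r_neq0 e0).
Qed.

(** One application of [log_step] to the free solution gives size
    [eps ^ p * ln X] and makes [gammaS p (3 + mu) / 2] the scaling exponent in
    [lower_bound_lt]. The equation for [b] raised to the power
    [gammaS p (3 + mu) / 2] then says that [X = M * b] reaches the threshold for
    a constant [M]. *)
Lemma log_lifespan (a M b : R) : nu * p = 1 -> 0 < gammaS p (3 + mu) ->
  1 <= a -> 2 * r0 <= a -> 16 * a <= M -> 1 <= b ->
  b * (ln (1 + b)) `^ (2 * (p - 1) / gammaS p (3 + mu)) =
    eps `^ (- (2 * p * (p - 1) / gammaS p (3 + mu))) ->
  blowup_threshold (p - 2 + mu / 2 * (p - 1)) <=
    (log_gain * d `^ p) `^ (p - 1) * M `^ (gammaS p (3 + mu) / 2) ->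
  T <= 6 * (M * b).
Proof.
move: p_gt1 eps_gt0 d_gt0 log_gain_gt0 => p1 e0 d0 G0 nup g0 a1 ar aM b1 bE big.
rewrite leNgt; apply/negP => TX.
set X := M * b in TX; set g := gammaS p (3 + mu) in g0 bE big.
have MX : M <= X by rewrite ler_peMr//; lra.
have X1 : 1 <= X by lra.
have Xr : 2 * r0 <= X by lra.
have XT : 11 / 2 * X < T by lra.
have bX : 1 + b <= X / (8 * a).
  rewrite ler_pdivlMr; last lra.
  apply: (@le_trans _ _ (b * (16 * a))); last first.
    by rewrite /X mulrC; apply: ler_wpM2r => //; lra.
  rewrite [leRHS](_ : _ = (b + b) * (8 * a)); last by ring.
  by apply: ler_wpM2r; lra.
set L := ln (1 + b) in bE.
have L0 : 0 < L by apply: ln_gt0; lra.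
have LX : L <= ln (X / (8 * a)) by rewrite ler_ln ?posrE//; lra.
set D := log_gain * (eps * d) `^ p * L.
have D0 : 0 < D by rewrite /D !mulr_gt0// powR_gt0// mulr_gt0.
have lbX : lower_bound X D (p - 2 + mu / 2 * (p - 1)).
  move=> t r tT hX h4.
  have hm : 0 <= eps * d by rewrite mulr_ge0 ?ltW.
  have h8 : 8 * a < t - r by lra.
  apply: le_trans (log_step a (eps * d) nu a1 ar hm nup
    (lower_bound_free a a1 ar) t r tT h8 h4).
  apply: ler_wpM2r; first by rewrite mulr_ge0 ?powR_ge0.
  rewrite /D; apply: ler_wpM2l; first by rewrite mulr_ge0 ?powR_ge0// ltW.
  apply: le_trans LX _; rewrite ler_ln ?posrE ?divr_gt0//; try lra.
  by apply: ler_wpM2r => //; rewrite invr_ge0; lra.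
have := lower_bound_lt X D _ X1 Xr XT D0 lbX.
rewrite ltNge => /negP; apply; apply: le_trans big _.
have -> : 3 - p - (p - 1) * (mu / 2 + (p - 2 + mu / 2 * (p - 1))) = g / 2.
  by rewrite /g /gammaS; field.
(* The equation for [b], to the power [g / 2]. *)
have key : b `^ (g / 2) * L `^ (p - 1) * eps `^ (p * (p - 1)) = 1.
  have := congr1 (fun x => x `^ (g / 2)) bE; rewrite powRM ?powR_ge0//; last lra.
  rewrite -!powRrM.
  rewrite (_ : 2 * (p - 1) / g * (g / 2) = p - 1); last first.
    by field; rewrite lt0r_neq0.
  rewrite (_ : - (2 * p * (p - 1) / g) * (g / 2) = - (p * (p - 1))); last first.
    by field; rewrite lt0r_neq0.
  by move=> ->; rewrite powRN mulVf// powR_eq0 negb_and (lt0r_neq0 e0).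
have b0 : 0 <= b by lra.
have M0 : 0 <= M by lra.
rewrite le_eqVlt; apply/orP; left; apply/eqP.
have DE : D = eps `^ p * (log_gain * d `^ p) * L.
  by rewrite /D powRM ?(ltW e0) ?(ltW d0)//; ring.
have Gd0 : 0 <= log_gain * d `^ p by rewrite mulr_ge0 ?powR_ge0// ltW.
move: Gd0 DE; move: (log_gain * d `^ p) => Gd Gd0 ->.
rewrite /X [(M * b) `^ _]powRM// [(_ * L) `^ _]powRM ?(ltW L0) ?mulr_ge0 ?powR_ge0//.
rewrite [(_ * Gd) `^ _]powRM ?powR_ge0// -powRrM.
by rewrite -[LHS]mulr1 -[X in _ * X = _]key; ring.
Qed.

(** In the critical case [log_step] reproduces the exponent [nu], so it can be
    iterated. The logarithmic scale [0 <= ln ((t - r) / a) <= S] is cut at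
    [S * (1 - 2 ^ (- k))]; the [k]-th step gains the logarithm
    [S / 2 ^ (k + 1) - ln 8], which is at least [S / 2 ^ (k + 2)] as long as the
    latter is at least [ln 8]. The growth rate [2 ^ (1 / (p - 1))] per step is
    the one whose [p - 1]-st power compensates for the halving. *)
Lemma critical_iteration (a S : R) (n : nat) : 1 <= a -> 2 * r0 <= a ->
  nu * p = 1 -> p - 2 + mu / 2 * (p - 1) = nu ->
  2 * 2 ^+ n * ln 8 <= S ->
  4 * 2 `^ (1 / (p - 1)) <= log_gain * (eps * d) `^ (p - 1) * S ->
  forall k, (k <= n)%N ->
    lower_bound (a * expR (S * (1 - 2^-1 ^+ k)))
      (eps * d * 2 `^ (k%:R / (p - 1))) nu.
Proof.
move: p_gt1 eps_gt0 d_gt0 log_gain_gt0 => p1 e0 d0 G0.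
move=> a1 ar nup crit Sn Sbig.
have m0 : 0 < eps * d by rewrite mulr_gt0.
have ln8 : 0 < ln (8 : R) by apply: ln_gt0; lra.
have S0 : 0 < S by apply: lt_le_trans Sn; rewrite !mulr_gt0// exprn_gt0.
elim=> [_|k IH kn].
  rewrite expr0 subrr mulr0 expR0 mulr1 mul0r powRr0 mulr1.
  exact: lower_bound_free.
have {}IH := IH (ltnW kn).
set h : R := 2^-1 ^+ k.
set m := eps * d * 2 `^ (k%:R / (p - 1)) in IH.
set ak := a * expR (S * (1 - 2^-1 ^+ k)) in IH.
have h0 : 0 < h by apply: exprn_gt0; lra.
have h1 : h <= 1 by apply: exprn_ile1; lra.
have aka : a <= ak.
  rewrite ler_peMr//; first lra.
  by apply: le_trans (expR_ge1Dx _); rewrite lerDl mulr_ge0 ?subr_ge0// ltW.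
have Sh : 4 * ln 8 <= S * h.
  apply: le_trans (_ : 2 * 2 ^+ n * ln 8 * h <= _);
    last by apply: ler_wpM2r => //; exact: ltW.
  rewrite [leRHS](_ : _ = 2 * (2 ^+ n * h) * ln 8); last by ring.
  apply: ler_wpM2r; first exact: ltW.
  have : 2 <= 2 ^+ n * h :> R.
    have hk1 : 2 ^+ k * h = 1 by rewrite /h -exprMn mulfV// expr1n.
    have -> : 2 ^+ n * h = 2 * 2 ^+ (n - k.+1) :> R.
      by rewrite -{1}(subnK kn) exprD exprS -!mulrA hk1 mulr1 mulrC.
    by rewrite ler_peMr// exprn_ege1//; lra.
  lra.
have m_gt0 : 0 < m by rewrite mulr_gt0// powR_gt0.
move=> t r tT ht h4.
have ak1 : a * expR (S * (1 - 2^-1 ^+ k.+1)) = ak * expR (S * h / 2).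
  rewrite /ak -mulrA -expRD; congr (_ * expR _).
  by rewrite exprS -/h; field.
rewrite ak1 in ht.
have ak0 : 0 < ak by lra.
have e8 : 8 < expR (S * h / 2).
  by rewrite -[ltLHS]lnK ?posrE// ltr_expR; lra.
have h8 : 8 * ak < t - r.
  by apply: lt_le_trans ht; rewrite mulrC ltr_pM2l.
have ak_1 : 1 <= ak by lra.
have ak_r : 2 * r0 <= ak by lra.
apply: le_trans (log_step ak m nu ak_1 ak_r (ltW m_gt0) nup IH t r tT h8 h4).
rewrite crit; apply: ler_wpM2r; first by rewrite mulr_ge0 ?powR_ge0.
have lnS : S * h / 4 <= ln ((t - r) / (8 * ak)).
  apply: (@le_trans _ _ (ln (expR (S * h / 2) / 8))).
    by rewrite ln_div ?posrE ?expR_gt0// expRK; lra.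
  rewrite ler_ln ?posrE ?divr_gt0 ?expR_gt0//; try lra.
  rewrite ler_pdivlMr; last lra.
  by rewrite (_ : _ / 8 * _ = ak * expR (S * h / 2)) //; field.
have Gm : 0 <= log_gain * m `^ p by rewrite mulr_ge0 ?powR_ge0// ltW.
apply: le_trans (ler_wpM2l Gm lnS).
have pn : p - 1 != 0 by rewrite lt0r_neq0//; lra.
have hE : h = 2 `^ (- k%:R) by rewrite /h powR_invn// exprVn.
have mp : m `^ p = (eps * d) * (eps * d) `^ (p - 1) *
    (2 `^ (k%:R / (p - 1)) * 2 `^ k%:R).
  rewrite /m powRM ?powR_ge0 ?(ltW m0)// mulr_powRB1 ?(ltW m0)//; last lra.
  congr (_ * _); rewrite -powRrM -powRD; last by rewrite lt0r_neq0 ?implybT.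
  by congr (_ `^ _); field.
have hk : h * 2 `^ k%:R = 1.
  by rewrite hE powRN mulVf// powR_eq0 negb_and lt0r_neq0.
have -> : log_gain * m `^ p * (S * h / 4) =
    eps * d * 2 `^ (k%:R / (p - 1)) *
      (log_gain * (eps * d) `^ (p - 1) * S / 4).
  rewrite mp -[RHS]mulr1 -[X in _ = _ * X]hk; by field.
have -> : 2 `^ (k.+1%:R / (p - 1)) = 2 `^ (k%:R / (p - 1)) * 2 `^ (1 / (p - 1)) :> R.
  rewrite -powRD; last by rewrite lt0r_neq0 ?implybT.
  by rewrite -(natr1 k) mulrDl.
rewrite mulrA ler_pM2l; last by rewrite mulr_gt0// powR_gt0.
by rewrite ler_pdivlMr// mulrC.
Qed.

(** The scaling exponent in [lower_bound_lt] vanishes in the critical case, so it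
    suffices to raise the coefficient above a fixed constant. This takes [n]
    steps with [2 ^ n] of order [eps ^ (- (p - 1))], and this is also the order
    of the logarithmic length that [n] steps require. *)
Lemma critical_lifespan (a s : R) : 1 <= a -> 2 * r0 <= a ->
  nu * p = 1 -> p - 2 + mu / 2 * (p - 1) = nu -> eps <= 1 ->
  4 * (1 + blowup_threshold nu / d `^ (p - 1)) * ln 8 <= s ->
  4 * 2 `^ (1 / (p - 1)) / (log_gain * d `^ (p - 1)) <= s ->
  T <= 6 * (a * expR (s * eps `^ (- (p - 1)))).
Proof.
move: p_gt1 eps_gt0 d_gt0 log_gain_gt0 (blowup_threshold_gt0 nu).
move=> p1 e0 d0 G0 K0 a1 ar nup crit e1 s1 s2; rewrite leNgt; apply/negP => TX.
set E := eps `^ _ in TX; set S := s * E in TX; set X := a * _ in TX.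
have E0 : 0 < E by rewrite powR_gt0.
have E1 : 1 <= E by apply: powRN_ge1 => //; lra.
have ep : eps `^ (p - 1) * E = 1.
  by rewrite /E powRN mulfV// powR_eq0 negb_and (lt0r_neq0 e0).
have dp : 0 < d `^ (p - 1) by rewrite powR_gt0.
set K := blowup_threshold nu in K0 s1.
pose Y := (1 + K / d `^ (p - 1)) * E.
have Kd : 0 < K / d `^ (p - 1) by rewrite divr_gt0.
have Y1 : 1 <= Y by rewrite /Y mulr_ege1//; lra.
have [n [nY Yn]] := pow2_between Y Y1.
have ln8 : 0 < ln (8 : R) by apply: ln_gt0; lra.
have S1 : 2 * 2 ^+ n * ln 8 <= S.
  apply: (@le_trans _ _ (2 * (2 * Y) * ln 8)).
    by apply: ler_wpM2r; [exact: ltW|lra].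
  rewrite [leLHS](_ : _ = 4 * (1 + K / d `^ (p - 1)) * ln 8 * E);
    last by rewrite /Y; ring.
  by apply: ler_wpM2r => //; exact: ltW.
have S2 : 4 * 2 `^ (1 / (p - 1)) <= log_gain * (eps * d) `^ (p - 1) * S.
  rewrite powRM ?(ltW e0) ?(ltW d0)//.
  rewrite [leRHS](_ : _ = s * (log_gain * d `^ (p - 1)) * (eps `^ (p - 1) * E)).
    by rewrite ep mulr1 -ler_pdivrMr// mulr_gt0.
  by rewrite /S; ring.
have lb := critical_iteration a S n a1 ar nup crit S1 S2 n (leqnn n).
have S0 : 0 < S by apply: lt_le_trans S1; rewrite !mulr_gt0// exprn_gt0.
have X1 : a <= X.
  rewrite ler_peMr//; first lra.
  by apply: le_trans (expR_ge1Dx _); rewrite lerDl ltW.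
have lbX : lower_bound X (eps * d * 2 `^ (n%:R / (p - 1))) nu.
  apply: lower_bound_le lb => //.
  rewrite ler_pM2l ?ler_expR; last lra.
  have : 0 < (2^-1 : R) ^+ n by apply: exprn_gt0; lra.
  by move=> h; rewrite ler_piMr ?(ltW S0)//; lra.
have X_1 : 1 <= X by lra.
have X_r : 2 * r0 <= X by lra.
have X_T : 11 / 2 * X < T by lra.
have D0 : 0 < eps * d * 2 `^ (n%:R / (p - 1)) by rewrite !mulr_gt0// powR_gt0.
have := lower_bound_lt X _ nu X_1 X_r X_T D0 lbX.
have -> : 3 - p - (p - 1) * (mu / 2 + nu) = 0.
  rewrite -crit.
  have : p * (p - 2 + mu / 2 * (p - 1)) = 1 by rewrite crit mulrC.
  move: (mu / 2) => m hm.
  rewrite (_ : _ - _ = 1 - p * (p - 2 + m * (p - 1))); last by ring.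
  by rewrite hm subrr.
rewrite powRr0 mulr1 ltNge => /negP; apply; rewrite -/K.
rewrite powRM ?mulr_ge0 ?powR_ge0 ?(ltW e0) ?(ltW d0)//.
rewrite [(eps * d) `^ _]powRM ?(ltW e0) ?(ltW d0)// -powRrM.
rewrite (_ : n%:R / (p - 1) * (p - 1) = n%:R); last first.
  by rewrite divfK// lt0r_neq0//; lra.
rewrite powR_mulrn//; apply: (@le_trans _ _ (eps `^ (p - 1) * d `^ (p - 1) * Y)).
  rewrite [leRHS](_ : _ = (d `^ (p - 1) + K) * (eps `^ (p - 1) * E)).
    by rewrite ep mulr1 lerDr ltW.
  by rewrite /Y; field; exact: lt0r_neq0.
by apply: ler_wpM2l => //; rewrite mulr_ge0 ?powR_ge0.
Qed.

End Nonlinear.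

(** * The exponents and the theorem *)

Lemma pS_root {R : realType} (mu : R) : 0 <= mu ->
  0 < pS (3 + mu) /\ gammaS (pS (3 + mu)) (3 + mu) = 0.
Proof.
move=> mu0; pose D : R := (4 + mu) ^+ 2 + 8 * (2 + mu).
have D0 : 0 <= D by rewrite /D; nra.
pose x : R := (4 + mu + Num.sqrt D) / (2 * (2 + mu)).
suff : [set p : R | 0 < p /\ gammaS p (3 + mu) = 0] (pS (3 + mu)) by [].
apply: (@xgetPex _ 0); exists x; split.
  by rewrite /x divr_gt0//; have := sqrtr_ge0 D; lra.
have hD : Num.sqrt D ^+ 2 = (4 + mu) ^+ 2 + 8 * (2 + mu) by rewrite sqr_sqrtr.
rewrite /gammaS /x.
move: (Num.sqrt D) hD => s hD.
apply: (@mulfI _ (4 * (2 + mu))); first by rewrite lt0r_neq0//; lra.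
rewrite mulr0 [LHS](_ : _ = (4 + mu) ^+ 2 + 8 * (2 + mu) - s ^+ 2).
  by rewrite hD subrr.
by field; rewrite lt0r_neq0//; lra.
Qed.

(** The identity used amounts to the strict decrease of [gammaS p n / p]. *)
Lemma gammaS_gt0 {R : realType} (mu p : R) : 0 <= mu -> 0 < p ->
  p < pS (3 + mu) -> 0 < gammaS p (3 + mu).
Proof.
move=> mu0 p0 pP; have [P0 rootP] := pS_root mu mu0.
move: (pS (3 + mu)) pP P0 rootP => P pP P0 rootP.
have e : gammaS p (3 + mu) * P =
    (P - p) * (2 + (2 + mu) * (p * P)) + gammaS P (3 + mu) * p.
  by rewrite /gammaS; ring.
rewrite -(pmulr_lgt0 _ P0) e rootP mul0r addr0.
apply: mulr_gt0; first by rewrite subr_gt0.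
by apply: addr_gt0 => //; apply: mulr_gt0; [lra|exact: mulr_gt0].
Qed.

(** The bound [1 <= b] comes from [eps <= 1]: for [b < 1] the left-hand side is
    less than [1], and the right-hand side is not. For the existence,
    the left-hand side is at least [b] once [b >= exp 1]. *)
Lemma b_eps_spec {R : realType} (p mu eps : R) : 1 < p ->
  0 < gammaS p (3 + mu) -> 0 < eps -> eps <= 1 ->
  1 <= b_eps p mu eps /\
  b_eps p mu eps *
    (ln (1 + b_eps p mu eps)) `^ (2 * (p - 1) / gammaS p (3 + mu)) =
    eps `^ (- (2 * p * (p - 1) / gammaS p (3 + mu))).
Proof.
move=> p1 g0 e0 e1; rewrite /b_eps.
set g := gammaS p (3 + mu) in g0 *; set e := 2 * (p - 1) / g.
set v := eps `^ _.
have e_gt0 : 0 < e by rewrite divr_gt0// mulr_gt0//; lra.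
have v1 : 1 <= v.
  apply: powRN_ge1 => //; rewrite divr_ge0 ?(ltW g0)//.
  by rewrite !mulr_ge0//; lra.
have ln1b (b : R) : 0 < b -> 0 < ln (1 + b) by move=> b0; apply: ln_gt0; lra.
pose f (b : R) := b * (ln (1 + b)) `^ e.
have f_le (b : R) : 0 < b -> b <= 1 -> f b <= b.
  move=> b0 b1; rewrite /f ler_piMr ?(ltW b0)// -[leRHS](powRr0 (ln (1 + b))).
  apply: ger_powR; last exact: ltW.
  by rewrite ln1b//= (le_trans (le_ln1Dx _))//; lra.
have f_ge (b : R) : expR 1 <= b -> b <= f b.
  move=> be; have b0 : 0 < b := lt_le_trans (expR_gt0 1) be.
  rewrite /f ler_peMr ?(ltW b0)// -[leLHS](powRr0 (ln (1 + b))).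
  apply: ler_powR; last exact: ltW.
  by rewrite -[leLHS]expRK ler_ln ?posrE ?expR_gt0//; lra.
have [b [b1 fb]] : exists b : R, 1 <= b /\ f b = v.
  have ex0 := expR_gt0 (1 : R).
  pose N := v + expR 1.
  have N1 : 1 <= N by rewrite /N; lra.
  have f1v : f 1 <= v by apply: le_trans (f_le 1 _ _) v1.
  have vfN : v <= f N by apply: le_trans (f_ge N _); rewrite /N; lra.
  have cf : {within `[1, N], continuous f}.
    apply: derivable_within_continuous => b; rewrite in_itv/= => /andP[b1 _].
    have b0 : 0 < b by lra.
    have ds : is_derive b 1 (fun x : R => 1 + x) 1.
      by apply: is_derive_eq; rewrite add0r mulr1.
    have b10 : 0 < 1 + b by lra.
    have dl := @is_derive1_comp _ _ (fun x => 1 + x) b _ _ (is_derive1_ln b10) ds.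
    have dp := @is_derive1_comp _ (fun y : R => y `^ e) (fun x : R => ln (1 + x)) b _ _
      (is_derive1_powR e (ln1b b b0)) dl.
    apply: derivableM; first exact: derivable_id.
    exact: (@ex_derive _ _ _ _ _ _ _ dp).
  have [|b] := @IVT R f 1 N v N1 cf.
    by rewrite ge_min f1v/= le_max vfN orbT.
  by rewrite in_itv/= => /andP[b1 _] fb; exists b.
have : [set b : R | 0 < b /\ f b = v] (xget 0 [set b : R | 0 < b /\ f b = v]).
  by apply: (@xgetPex _ 0); exists b; split => //; lra.
move: (xget _ _) => z /= [z0 fz]; split => //.
rewrite leNgt; apply/negP => z1.
by have := f_le z z0 (ltW z1); lra.
Qed.

Lemma lifespan_le {R : realType} (w phi psi : R -> R) (p eps B : R) :
  (forall T u, 0 < T -> solution_on w phi psi p eps T u -> T <= B) ->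
  (lifespan w phi psi p eps <= B%:E)%E.
Proof.
move=> h; apply: ge_ereal_sup => _ [T [T0 [u su]] <-].
by rewrite lee_fin; apply: h su.
Qed.

Theorem theorem2p4 (R : realType) (mu : R) (w : R -> R)
    (r0 delta : R) (wt : R -> R) (phi psi : R -> R) (kappa p : R)
    (mu_ge0 : 0 <= mu)
    (w_cont : {within `[0, +oo[, continuous w})
    (w_C1 : forall r : R, 0 < r ->
      derivable w r 1 /\ {for r, continuous (derive1 w)})
    (r0_gt0 : 0 < r0) (delta_gt0 : 0 < delta)
    (w_asymp : forall r : R, r0 <= r -> 2 * w r = mu / r + wt r)
    (wt_decay : exists2 A : R, 0 < A &
      forall r : R, r0 <= r -> `|wt r| <= A * r `^ (- 1 - delta))
    (phi_cont : {within `[0, +oo[, continuous phi})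
    (psi_cont : {within `[0, +oo[, continuous psi})
    (phi_eq0 : forall r : R, 0 <= r -> phi r = 0)
    (kappa_gt0 : 0 < kappa)
    (psi_lower : forall r : R, 0 <= r -> (1 + r) `^ (- kappa) <= psi r) :
  let nu := kappa - mu / 2 - 1 in
  ((1 < p /\ p <= pS (3 + mu)) /\ p * nu = 1) \/
  ((1 < p /\ p < pF kappa) /\ p * nu < 1) ->
  exists C eps0 : R, [/\ 0 < C, 0 < eps0 &
    forall eps : R, 0 < eps -> eps <= eps0 ->
    [/\ p = pS (3 + mu) /\ p * nu = 1 ->
          (lifespan w phi psi p eps
             <= (expR (C * eps `^ (- (p - 1))))%:E)%E,
        (1 < p /\ p < pS (3 + mu)) /\ p * nu = 1 ->
          (lifespan w phi psi p eps <= (C * b_eps p mu eps)%:E)%E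
      & (1 < p /\ p < pF kappa) /\ p * nu < 1 ->
          (lifespan w phi psi p eps
             <= (C * eps `^ (- ((p - 1) / gammaF p kappa)))%:E)%E]].
Proof.
move=> nu hyp.
have [A A0 wtA] := wt_decay.
have [W _ hW] :=
  bigW_sub_ln_bounded mu r0 delta A w wt w_cont r0_gt0 delta_gt0 A0 w_asymp wtA.
have [c c0 Ek] := kernel_lower mu r0 W w r0_gt0 hW.
have [d d0 fl] := uL_lower mu r0 c kappa w phi psi mu_ge0 r0_gt0 c0 Ek w_cont
  psi_cont phi_eq0 kappa_gt0 psi_lower.
pose a := Num.max 1 (2 * r0).
have a1 : 1 <= a by rewrite le_max lexx.
have ar : 2 * r0 <= a by rewrite le_max lexx orbT.
have p1 : 1 < p by case: hyp => [[[]]|[[]]].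
have p0 : 0 < p by lra.
have [P0 rootP] := pS_root mu mu_ge0.
have thr th : 0 <= blowup_threshold mu c p th.
  by apply: ltW; exact: blowup_threshold_gt0.
case: hyp => [[[_ pP] pnu]|[[_ pF'] pnu]]; last first.
  have g0 : 0 < gammaF p kappa.
    move: pF'; rewrite /pF /gammaF -ltrBlDl ltr_pdivlMr//; lra.
  have [M aM big] := exists_powR_ge a (d `^ (p - 1)) (gammaF p kappa)
    (blowup_threshold mu c p nu) (powR_gt0 _ d0) g0 (thr nu).
  exists (6 * M), 1; split => //; first lra.
  move=> eps e0 e1; split => [[_ h]|[_ h]|_];
    [by rewrite h ltxx in pnu|by rewrite h ltxx in pnu|].
  apply: lifespan_le => T u _ sol; rewrite -mulrA.
  apply: (power_lifespan mu r0 c d nu p eps T w phi psi u mu_ge0 r0_gt0 c0 d0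
    p1 e0 Ek fl sol M kappa) => //; lra.
have nup : nu * p = 1 by rewrite mulrC.
move: pP; rewrite le_eqVlt => /orP[/eqP pE|pP].
  have crit : p - 2 + mu / 2 * (p - 1) = nu.
    apply: (@mulfI _ p); first exact: lt0r_neq0.
    rewrite pnu; move: rootP; rewrite -pE /gammaS => rootP.
    have : p * (p - 2 + mu / 2 * (p - 1)) = 1 -
      (2 + (3 + mu + 1) * p - (3 + mu - 1) * p ^+ 2) / 2 by field.
    by rewrite rootP mul0r subr0.
  pose s := Num.max (4 * (1 + blowup_threshold mu c p nu / d `^ (p - 1)) * ln 8)
    (4 * 2 `^ (1 / (p - 1)) / (log_gain mu c p * d `^ (p - 1))).
  have s0 : 0 < s.
    rewrite lt_max; apply/orP; right.
    by rewrite divr_gt0 ?mulr_gt0 ?powR_gt0 ?log_gain_gt0.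
  have l6 : 0 < ln (6 * a) by apply: ln_gt0; lra.
  exists (s + ln (6 * a)), 1; split => //; first lra.
  move=> eps e0 e1; split => [_|[[_ h] _]|[_ h]];
    [|by rewrite -pE ltxx in h|by rewrite pnu ltxx in h].
  apply: lifespan_le => T u _ sol.
  have := critical_lifespan mu r0 c d nu p eps T w phi psi u mu_ge0 r0_gt0 c0 d0
    p1 e0 Ek fl sol a s a1 ar nup crit e1.
  rewrite !le_max !lexx orbT => /(_ isT isT) /le_trans; apply.
  set E := eps `^ _.
  have E1 : 1 <= E by apply: powRN_ge1 => //; lra.
  rewrite mulrA -[X in X * _ <= _]lnK ?posrE; last lra.
  have : ln (6 * a) <= ln (6 * a) * E by rewrite ler_peMr// ltW.
  by rewrite -expRD ler_expR mulrDl; lra.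
have g0 := gammaS_gt0 mu p mu_ge0 p0 pP.
have g20 : 0 < gammaS p (3 + mu) / 2 by rewrite divr_gt0.
have k0 : 0 < (log_gain mu c p * d `^ p) `^ (p - 1).
  by rewrite powR_gt0// mulr_gt0 ?powR_gt0// log_gain_gt0.
(* The lower bound [16 * a] turns [ln (X / (8 * a))] into at least [ln (1 + b)]. *)
have [M aM big] := exists_powR_ge (16 * a) _ _ _ k0 g20
  (thr (p - 2 + mu / 2 * (p - 1))).
exists (6 * M), 1; split => //; first lra.
move=> eps e0 e1; split => [[h _]|_|[_ h]];
  [by rewrite -h ltxx in pP| |by rewrite pnu ltxx in h].
have [b1 bE] := b_eps_spec p mu eps p1 g0 e0 e1.
apply: lifespan_le => T u _ sol; rewrite -mulrA.
exact: (log_lifespan mu r0 c d nu p eps T w phi psi u mu_ge0 r0_gt0 c0 d0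
  p1 e0 Ek fl sol a M).
Qed.
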